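(* Let $0<M<N$ be integers, let $a_{ij}\in\mathbb{R}$ ($i=1,\dots,M$, $j=1,\dots,N$) and $g_i\in\mathbb{R}$ ($i=1,\dots,M$) be given, and assume that $$\sum_{j=1}^N a_{ij}\ge 0,\quad i=1,\dots,M,\qquad\qquad \sum_{i,j=1}^M v_i\,a_{ij}\,v_j>0\quad\forall\,(v_1,\dots,v_M)\in\mathbb{R}^M\setminus\{0\}.$$ Let index sets $S_i$ satisfy $\{j\in\{1,\dots,N\}\setminus\{i\}\,;\,a_{ij}\neq0\}\subset S_i\subset\{1,\dots,N\}\setminus\{i\}$ for $i=1,\dots,M$. For every $\mathrm{U}\in\mathbb{R}^N$ let $\mathbb{B}(\mathrm{U})=(b_{ij}(\mathrm{U}))_{i,j=1}^N$ be a real matrix such that, for all $\mathrm{U}$: $b_{ij}(\mathrm{U})=b_{ji}(\mathrm{U})$ for $i,j=1,\dots,N$; $b_{ij}(\mathrm{U})\le 0$ for $i\ne j$, $i,j=1,\dots,N$; $\sum_{j=1}^N b_{ij}(\mathrm{U})=0$ for $i=1,\dots,N$; and $b_{ij}(\mathrm{U})=0$ for all $i=1,\dots,M$ and $j\notin S_i\cup\{i\}$. Assume: (A1) for any $i\in\{1,\dots,M\}$ and $j\in\{1,\dots,N\}$, the function $\mathrm{U}=(u_1,\dots,u_N)\mapsto b_{ij}(\mathrm{U})(u_j-u_i)$ is continuous on $\mathbb{R}^N$, and for any $i\in\{1,\dots,M\}$ and $j\in\{M+1,\dots,N\}$, the function $b_{ij}$ is bounded on $\mathbb{R}^N$; (A2)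 for any $\mathrm{U}=(u_1,\dots,u_N)\in\mathbb{R}^N$ and any $i\in\{1,\dots,M\}$, if either $u_i>u_j$ for all $j\in S_i$ or $u_i<u_j$ for all $j\in S_i$, then $a_{ij}+b_{ij}(\mathrm{U})\le0$ for all $j\in S_i$. Consider any nonempty set $R\subset\{1,\dots,M\}$, denote $P:=R\cup\bigcup_{i\in R}S_i$ and $Q:=P\setminus R$, and assume that $Q\neq\emptyset$. Let $\mathrm{U}=(u_1,\dots,u_N)\in\mathbb{R}^N$ be any vector satisfying $\sum_{j=1}^N (a_{ij}+b_{ij}(\mathrm{U}))\,u_j=g_i$ for $i=1,\dots,M$. Then $$g_i\le 0\ \ \forall\, i\in R\quad\Rightarrow\quad \max_{i\in P}u_i\le\max_{i\in Q}u_i^+,$$ $$g_i\ge 0\ \ \forall\, i\in R\quad\Rightarrow\quad \min_{i\in P}u_i\ge\min_{i\in Q}u_i^-.$$ If, in addition, $\sum_{j=1}^N a_{ij}=0$ for all $i\in R$, then $$g_i\le 0\ \ \forall\, i\in R\quad\Rightarrow\quad \max_{i\in P}u_i=\max_{i\in Q}u_i,$$ $$g_i\ge 0\ \ \forall\, i\in R\quad\Rightarrow\quad \min_{i\in P}u_i=\min_{i\in Q}u_i.$$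
   Context: For a real number $a$, $a^+=\max\{a,0\}$ and $a^-=\min\{a,0\}$. The set $P$ may contain indices from $\{M+1,\dots,N\}$. *)

(* Defs.v *)
From HB Require Import structures.
From mathcomp Require Import all_boot all_order all_algebra.
From mathcomp Require Import all_classical all_reals all_analysis.
Set Implicit Arguments.
Unset Strict Implicit.
Unset Printing Implicit Defensive.
Import Order.TTheory GRing.Theory Num.Theory.
Import numFieldNormedType.Exports.
Local Open Scope ring_scope.

(* Maximum and minimum of [f] over the finite index set [A]; the value on the
   empty set is a dummy. *)
Definition max_over (R : realType) (I : finType) (A : {set I}) (f : I -> R) : R :=
  if [pick i in A] is Some i0 then f [arg max_(i > i0 in A) f i]%O else 0.

Definition min_over (R : realType) (I : finType) (A : {set I}) (f : I -> R) : R :=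
  if [pick i in A] is Some i0 then f [arg min_(i < i0 in A) f i]%O else 0.

Lemma max_overP (R : realType) (I : finType) (A : {set I}) (f : I -> R) :
  A != finset.set0 ->
  (exists2 i, i \in A & max_over A f = f i) /\
  (forall i, i \in A -> f i <= max_over A f).
Proof.
move=> /set0Pn [k kA]; rewrite /max_over; case: pickP => [i0 i0A|/(_ k)].
  by case: arg_maxP => // i iA imax; split; first exists i.
by rewrite kA.
Qed.

Lemma min_overP (R : realType) (I : finType) (A : {set I}) (f : I -> R) :
  A != finset.set0 ->
  (exists2 i, i \in A & min_over A f = f i) /\
  (forall i, i \in A -> min_over A f <= f i).
Proof.
move=> /set0Pn [k kA]; rewrite /min_over; case: pickP => [i0 i0A|/(_ k)].
  by case: arg_minP => // i iA imin; split; first exists i.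
by rewrite kA.
Qed.

(* Main.v *)
(* Let m be the maximum of u over P and suppose that m exceeds u on Q, so that m
   is attained only at a set J of indices in I. Positive definiteness, tested
   with the indicator vector of J, and the signs and zero row sums of B(U) give
   a row k in J whose entries a_kj + b_kj(U) have a positive sum over J.
   Raising u_k by a small t > 0 makes k a strict local maximum, so (A2) applies;
   letting t tend to 0 with (A1) gives a_kj + b_kj(U) <= 0 whenever u_j < u_k.
   The k-th equation then forces these entries to vanish, so the whole k-th row
   of A has a positive sum, which contradicts g_k <= 0 if m > 0 and contradicts
   the vanishing of the row sum otherwise. Minima follow by passing to -U. *)
Require Import Defs.
From HB Require Import structures.
From mathcomp Require Import all_boot all_order all_algebra.
From mathcomp Require Import all_classical all_reals all_analysis.
Set Implicit Arguments.
Unset Strict Implicit.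
Unset Printing Implicit Defensive.
Import Order.TTheory GRing.Theory Num.Theory.
Import numFieldNormedType.Exports.
Local Open Scope ring_scope.

(** With [U] frozen the argument is linear algebra for the single matrix [c], standing for A + B(U).
    Positive definiteness enters only through block sums over index sets [J], and (A1), (A2) only
    through the sign condition at a non-strict local maximum. *)
Lemma strong_max_principle (R : realType) (X Y : finType) (w : X -> Y)
    (w_inj : injective w) (c : X -> Y -> R) (S : X -> {set Y}) (I : {set X})
    (u : Y -> R) (m : R) :
  (forall J : {set X}, J != finset.set0 ->
     0 < \sum_(i in J) \sum_(j in J) c i (w j)) ->
  (forall i j, j \notin w i |: S i -> c i j = 0) ->
  (forall i, (forall j, j \in S i -> u j <= u (w i)) ->
     forall j, j \in S i -> u j < u (w i) -> c i j <= 0) ->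
  (forall i, i \in I -> \sum_j c i j * u j <= 0) ->
  (forall i, 0 <= \sum_j c i j) ->
  0 < m \/ (forall i, i \in I -> \sum_j c i j = 0) ->
  let P := (w @: I) :|: \bigcup_(i in I) S i in
  (forall j, j \in P -> u j <= m) ->
  (forall j, j \in P :\: (w @: I) -> u j < m) ->
  forall j, j \in P -> u j < m.
Proof.
move=> cpos csupp csign sub row_ge0 m_or P leP ltQ j jP.
rewrite lt_neqAle leP // andbT; apply/eqP => ujm.
pose J := [set i in I | u (w i) == m].
have PJ l : l \in P -> u l = m -> exists2 i, i \in J & l = w i.
  move=> lP ulm; have [/imsetP[i iI lE]|lI] := boolP (l \in w @: I).
    by exists i => //; rewrite inE iI -lE ulm eqxx.
  by have := ltQ l; rewrite inE lI lP ulm ltxx => /(_ isT).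
have [i0 i0J _] := PJ j jP ujm.
have /cpos Jpos : J != finset.set0 by apply/set0Pn; exists i0.
have [k kJ kpos] : exists2 k, k \in J & 0 < \sum_(j in J) c k (w j).
  apply/exists_inP; apply: contraLR Jpos => /exists_inPn Jneg.
  by rewrite -leNgt sumr_le0// => i iJ; rewrite leNgt Jneg.
move: (kJ); rewrite inE => /andP[kI /eqP ukm].
have suppP l : l \in w k |: S k -> l \in P.
  rewrite in_setU1 => /predU1P[->|lS]; rewrite inE.
    by rewrite imset_f.
  by apply/orP; right; apply/bigcupP; exists k.
(* Outside the support the coefficient is 0, and where [u l = m] the other factor is 0. In the
   remaining case [l] lies in [S k] strictly below the maximum, so both factors are nonpositive. *)
have term_ge0 l : 0 <= c k l * (u l - m).
  have [lS|/csupp ->] := boolP (l \in w k |: S k); last by rewrite mul0r.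
  have := leP l (suppP l lS); rewrite le_eqVlt => /predU1P[->|ulm].
    by rewrite subrr mulr0.
  rewrite mulr_le0 ?subr_le0 ?(ltW ulm)//.
  move: lS; rewrite in_setU1 => /predU1P[lE|lS].
    by rewrite lE ukm ltxx in ulm.
  apply: csign; rewrite ?ukm// => h hS.
  by rewrite leP// suppP// in_setU1 hS orbT.
have sumE : \sum_l c k l * (u l - m) = \sum_l c k l * u l - m * \sum_l c k l.
  by rewrite mulr_sumr -sumrB; apply: eq_bigr => l _; rewrite mulrBr (mulrC m).
have mrow_ge0 : 0 <= m * \sum_l c k l.
  by case: m_or => [m0|->//]; rewrite ?mulr0// mulr_ge0// ltW.
(* The sum is squeezed: its terms are nonnegative, while [sumE] writes it as a nonpositive row value
   minus a nonnegative quantity. *)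
have sum0 : \sum_l c k l * (u l - m) = 0.
  apply/eqP; rewrite eq_le sumr_ge0// andbT sumE subr_le0.
  exact: le_trans (sub k kI) mrow_ge0.
have term0 l : c k l * (u l - m) = 0.
  by have /psumr_eq0P := sum0; apply.
(* Since every term vanishes, [c k l] is 0 unless [u l = m]; the full row sum thus reduces to the
   sum over [J], positive by the choice of [k]. *)
have row_pos : 0 < \sum_l c k l.
  rewrite (bigID (mem (w @: J)))/= [X in _ + X]big1 ?addr0.
    by rewrite big_imset//=; exact: in2W w_inj.
  move=> l lJ; have [lS|/csupp //] := boolP (l \in w k |: S k).
  have /eqP := term0 l; rewrite mulf_eq0 => /orP[/eqP //|].
  rewrite subr_eq0 => /eqP /(PJ _ (suppP _ lS))[i iJ lE].
  by rewrite lE imset_f in lJ.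
case: m_or => [m0|/(_ k kI) row0]; last by rewrite row0 ltxx in row_pos.
have := mulr_gt0 m0 row_pos.
move: sum0; rewrite sumE => /subr0_eq <-.
by rewrite ltNge sub.
Qed.

(** Since [b] itself may be discontinuous, the limit is taken in its product with the difference of
    coordinates. This difference is nonzero at [U], so the sign of [x + b U] can be recovered. *)
Lemma nonstrict_max_sign (R : realType) (N : nat) (S : {set 'I_N}) (i j : 'I_N)
    (x : R) (b : 'rV[R]_N -> R) (U : 'rV[R]_N) :
  continuous (fun V : 'rV[R]_N => b V * (V 0 j - V 0 i)) ->
  (forall V : 'rV[R]_N, (forall l, l \in S -> V 0 l < V 0 i) -> x + b V <= 0) ->
  i \notin S -> (forall l, l \in S -> U 0 l <= U 0 i) ->
  j \in S -> U 0 j < U 0 i -> x + b U <= 0.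
Proof.
move=> bc xb iS Umax jS Uji.
pose V (t : R) : 'rV[R]_N := U + t *: delta_mx 0 i.
have Vc : continuous V.
  move=> t; rewrite /V; apply: cvgD; first exact: cvg_cst.
  exact: scalel_continuous.
have VE t l : V t 0 l = U 0 l + t * (l == i)%:R by rewrite !mxE eqxx.
have VEi t : V t 0 i = U 0 i + t by rewrite VE eqxx mulr1.
have VEj t l : l \in S -> V t 0 l = U 0 l.
  by move=> lS; rewrite VE; case: eqP lS iS => [->->//|]; rewrite mulr0 addr0.
have V0 : V 0 = U by rewrite /V scale0r addr0.
(* This is [x + b (V t)] times the coordinate difference, expanded so that [b] occurs only inside
   the continuous product. *)
pose f t := x * (U 0 j - (U 0 i + t)) + b (V t) * (V t 0 j - V t 0 i).
have f0 : f 0 = (x + b U) * (U 0 j - U 0 i) by rewrite /f V0 addr0 mulrDl.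
have fc : {for 0, continuous f}.
  apply: continuousD.
    apply: cvgM; first exact: cvg_cst.
    apply: cvgB; first exact: cvg_cst.
    by apply: cvgD; [exact: cvg_cst|exact: cvg_id].
  apply: (@continuous_comp _ _ _ V (fun W : 'rV[R]_N => b W * (W 0 j - W 0 i))).
    exact: Vc.
  exact: bc.
have f_ge0 t : 0 < t -> 0 <= f t.
  move=> t0; rewrite /f VEi VEj// -mulrDl mulr_le0//.
    by apply: xb => l lS; rewrite VEi VEj// ltr_pwDr ?Umax.
  by rewrite subr_le0 ltW// ltr_wpDr// ltW.
(* The sign is known only for [t > 0], hence a one-sided limit. *)
have : 0 <= f 0.
  have : (f t @[t --> 0^'+] --> f 0)%classic by exact: cvg_at_right_filter.
  move=> /cvgr_to_ge; apply; near=> t; apply: f_ge0.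
  by near: t; exact: nbhs_right_gt.
by rewrite f0 nmulr_lge0 ?subr_lt0.
Unshelve. all: by end_near. Qed.

(** Only the maximum half of (A2) is assumed, so that the lemma applies both to [B] at [U] and, by
    the minimum half, to the reflected family [B (- V)] at [- U]. *)
Lemma discrete_max_principle (R : realType) (M N : nat) (a : 'M[R]_(M, N))
    (g : 'I_M -> R) (w : 'I_M -> 'I_N) (S : 'I_M -> {set 'I_N})
    (B : 'rV[R]_N -> 'M[R]_N) (I : {set 'I_M}) (U : 'rV[R]_N) (m : R) :
  injective w ->
  (forall i, 0 <= \sum_(j < N) a i j) ->
  (forall v : 'rV[R]_M, v != 0 ->
     0 < \sum_(i < M) \sum_(j < M) v 0 i * a i (w j) * v 0 j) ->
  (forall i j, j != w i -> a i j != 0 -> j \in S i) ->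
  (forall i, w i \notin S i) ->
  (forall i j, i != j -> B U i j <= 0) ->
  (forall i, \sum_(j < N) B U (w i) j = 0) ->
  (forall i j, j \notin w i |: S i -> B U (w i) j = 0) ->
  (forall i j, continuous (fun V : 'rV[R]_N => B V (w i) j * (V 0 j - V 0 (w i)))) ->
  (forall (V : 'rV[R]_N) i, (forall j, j \in S i -> V 0 j < V 0 (w i)) ->
     forall j, j \in S i -> a i j + B V (w i) j <= 0) ->
  (forall i, \sum_(j < N) (a i j + B U (w i) j) * U 0 j = g i) ->
  (forall i, i \in I -> g i <= 0) ->
  0 < m \/ (forall i, i \in I -> \sum_(j < N) a i j = 0) ->
  let P := (w @: I) :|: \bigcup_(i in I) S i in
  (forall j, j \in P -> U 0 j <= m) ->
  (forall j, j \in P :\: (w @: I) -> U 0 j < m) ->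
  forall j, j \in P -> U 0 j < m.
Proof.
move=> w_inj a_row a_pos S_lb S_ub B_le0 B_row B_S B_cont A2 UE g_le0 m_or.
have rowE i : \sum_j (a i j + B U (w i) j) = \sum_j a i j.
  by rewrite big_split/= B_row addr0.
apply: (strong_max_principle w_inj (c := fun i j => a i j + B U (w i) j)).
- move=> J J0.
  under eq_bigr do rewrite big_split/=.
  rewrite big_split/= ltr_pwDl//; last first.
    (* By the zero row sum, the part of a row of B(U) over [J] is minus the part outside [J], which
       consists of nonpositive off-diagonal entries. *)
    apply: sumr_ge0 => i iJ.
    have := B_row i; rewrite (bigID (mem (w @: J)))/= big_imset/=; last first.
      exact: in2W w_inj.
    move=> /eqP; rewrite addr_eq0 => /eqP ->; rewrite oppr_ge0 sumr_le0// => l lJ.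
    by rewrite B_le0//; apply: contraNneq lJ => <-; rewrite imset_f.
  pose v : 'rV[R]_M := \row_i (i \in J)%:R.
  have /a_pos : v != 0.
    case/set0Pn: J0 => i iJ; apply/eqP => /rowP/(_ i).
    by rewrite !mxE iJ => /eqP; rewrite oner_eq0.
  rewrite [X in _ -> 0 < X]big_mkcond/=; congr (0 < _); apply: eq_bigr => i _.
  rewrite mxE; case: ifP => _; last by rewrite big1// => j _; rewrite !mul0r.
  rewrite [RHS]big_mkcond/=; apply: eq_bigr => j _.
  by rewrite mxE mul1r; case: ifP => _; rewrite ?mulr1 ?mulr0.
- move=> i j jS; rewrite B_S// addr0; apply: contraNeq jS => aij.
  by rewrite in_setU1; have [//|jw] := eqVneq j (w i); rewrite S_lb.
- move=> i Umax j jS.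
  apply: (nonstrict_max_sign (S := S i) (b := fun V => B V (w i) j)) => //.
  by move=> V /A2; exact.
- by move=> i iI; rewrite UE g_le0.
- by move=> i; rewrite rowE.
- by case: m_or => [|row0]; [left|right=> i iI; rewrite rowE row0].
Qed.

Theorem theorem3 (R : realType) (M N : nat) (hM : (0 < M)%N) (hMN : (M < N)%N)
  (a : 'M[R]_(M, N)) (g : 'I_M -> R)
  (w := widen_ord (ltnW hMN) : 'I_M -> 'I_N)
  (ha_row : forall i, 0 <= \sum_(j < N) a i j)
  (ha_pos : forall v : 'rV[R]_M, v != 0 ->
     0 < \sum_(i < M) \sum_(j < M) v 0 i * a i (w j) * v 0 j)
  (S : 'I_M -> {set 'I_N})
  (hS_lb : forall i j, j != w i -> a i j != 0 -> j \in S i)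
  (hS_ub : forall i, w i \notin S i)
  (B : 'rV[R]_N -> 'M[R]_N)
  (hB_sym : forall U i j, B U i j = B U j i)
  (hB_le0 : forall U i j, i != j -> B U i j <= 0)
  (hB_row : forall U (i : 'I_M), \sum_(j < N) B U (w i) j = 0)
  (hB_S : forall U (i : 'I_M) (j : 'I_N),
     j \notin w i |: S i -> B U (w i) j = 0)
  (hA1_cont : forall (i : 'I_M) (j : 'I_N),
     continuous (fun U : 'rV[R]_N => B U (w i) j * (U 0 j - U 0 (w i))))
  (hA1_bnd : forall (i : 'I_M) (j : 'I_N), (M <= j)%N ->
     bounded_fun (fun U : 'rV[R]_N => B U (w i) j))
  (hA2 : forall (U : 'rV[R]_N) (i : 'I_M),
     (forall j, j \in S i -> U 0 j < U 0 (w i)) \/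
     (forall j, j \in S i -> U 0 (w i) < U 0 j) ->
     forall j, j \in S i -> a i j + B U (w i) j <= 0)
  (I : {set 'I_M}) (hI : I != finset.set0)
  (P := (w @: I) :|: \bigcup_(i in I) S i)
  (Q := P :\: (w @: I))
  (hQ : Q != finset.set0)
  (U : 'rV[R]_N)
  (hU : forall i : 'I_M, \sum_(j < N) (a i j + B U (w i) j) * U 0 j = g i) :
  [/\ (forall i, i \in I -> g i <= 0) ->
        max_over P (fun i => U 0 i) <= max_over Q (fun i => Num.max (U 0 i) 0),
      (forall i, i \in I -> 0 <= g i) ->
        min_over Q (fun i => Num.min (U 0 i) 0) <= min_over P (fun i => U 0 i)
    & (forall i, i \in I -> \sum_(j < N) a i j = 0) ->
      ((forall i, i \in I -> g i <= 0) ->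
         max_over P (fun i => U 0 i) = max_over Q (fun i => U 0 i)) /\
      ((forall i, i \in I -> 0 <= g i) ->
         min_over P (fun i => U 0 i) = min_over Q (fun i => U 0 i))].
Proof.
have w_inj : injective w by move=> i j /(congr1 val) /= ij; exact: val_inj.
have max_lt : (forall i, i \in I -> g i <= 0) ->
    forall m, 0 < m \/ (forall i, i \in I -> \sum_(j < N) a i j = 0) ->
    (forall j, j \in P -> U 0 j <= m) -> (forall j, j \in Q -> U 0 j < m) ->
    forall j, j \in P -> U 0 j < m.
  move=> g_le0 m m_or; apply: (discrete_max_principle (B := B) (g := g)) => //.
  - by move=> i j; exact: hB_le0.
  - by move=> i j; exact: hB_S.
  - by move=> V i Vmax; exact: hA2 (or_introl Vmax).
have min_gt : (forall i, i \in I -> 0 <= g i) ->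
    forall m, m < 0 \/ (forall i, i \in I -> \sum_(j < N) a i j = 0) ->
    (forall j, j \in P -> m <= U 0 j) -> (forall j, j \in Q -> m < U 0 j) ->
    forall j, j \in P -> m < U 0 j.
  move=> g_ge0 m m_or geP gtQ j jP.
  have mxNE (V : 'rV[R]_N) k : (- V) 0 k = - V 0 k by rewrite mxE.
  rewrite -ltrN2 -mxNE.
  apply: (discrete_max_principle (B := fun V => B (- V)) (g := fun i => - g i)
    (a := a) (w := w) (S := S) (I := I)) => //.
  - by move=> i k; exact: hB_le0.
  - by move=> i k; exact: hB_S.
  - move=> i k V.
    (* The flux of the reflected family is the original flux conjugated by negation, so (A1) carries
       over. *)
    have -> : (fun V : 'rV[R]_N => B (- V) (w i) k * (V 0 k - V 0 (w i))) =
        -%R \o (fun V : 'rV[R]_N => B V (w i) k * (V 0 k - V 0 (w i))) \o -%R.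
      by apply/funext => W /=; rewrite !mxNE -mulrN opprB opprK addrC.
    apply: continuous_comp; first exact: opp_continuous.
    by apply: continuous_comp; [exact: hA1_cont|exact: opp_continuous].
  - move=> V i Vmax; apply: (hA2 (- V) i); right=> k kS.
    by rewrite !mxNE ltrN2 Vmax.
  - by move=> i; rewrite opprK -hU -sumrN; apply: eq_bigr => k _; rewrite mxNE mulrN.
  - by move=> i iI; rewrite oppr_le0 g_ge0.
  - by case: m_or => [m0|]; [left; rewrite oppr_gt0|right].
  - by move=> k kP; rewrite mxNE lerN2 geP.
  - by move=> k kQ; rewrite mxNE ltrN2 gtQ.
have QP j : j \in Q -> j \in P by rewrite inE => /andP[].
(* Nonemptiness keeps the dummy value of [max_over] and [min_over] out of play. *)
have P0 : P != finset.set0.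
  by case/set0Pn: hQ => j /QP jP; apply/set0Pn; exists j.
have [[p pP maxE] max_ge] := max_overP (fun i => U 0 i) P0.
have [[q qP minE] min_le] := min_overP (fun i => U 0 i) P0.
have [[p' p'Q maxQE] maxQ_ge] := max_overP (fun i => U 0 i) hQ.
have [[q' q'Q minQE] minQ_le] := min_overP (fun i => U 0 i) hQ.
have [_ maxQ0_ge] := max_overP (fun i => Num.max (U 0 i) 0) hQ.
have [_ minQ0_le] := min_overP (fun i => Num.min (U 0 i) 0) hQ.
split=> [g_le0|g_ge0|row0].
(* If the maximum over [P] exceeded all positive parts on [Q], it would be positive because [Q] is
   nonempty; [max_lt] would then make it exceed its own value at [p]. *)
- rewrite leNgt; apply/negP => ltPQ.
  have ltm j (jQ : j \in Q) := le_lt_trans (maxQ0_ge j jQ) ltPQ.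
  have : U 0 p < max_over P (fun i => U 0 i).
    apply: max_lt => //.
      by left; have := ltm _ p'Q; rewrite gt_max => /andP[].
    by move=> j /ltm; rewrite gt_max => /andP[].
  by rewrite maxE ltxx.
- rewrite leNgt; apply/negP => ltPQ.
  have ltm j (jQ : j \in Q) := lt_le_trans ltPQ (minQ0_le j jQ).
  have : min_over P (fun i => U 0 i) < U 0 q.
    apply: min_gt => //.
      by left; have := ltm _ q'Q; rewrite lt_min => /andP[].
    by move=> j /ltm; rewrite lt_min => /andP[].
  by rewrite minE ltxx.
- split=> [g_le0|g_ge0]; apply/eqP; rewrite eq_le.
  (* One inequality is the inclusion of [Q] in [P]; for the other, zero row sums replace the
     positivity of the maximum, so no truncation at 0 is needed. *)
  + apply/andP; split; last by rewrite maxQE max_ge// QP.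
    rewrite leNgt; apply/negP => ltPQ.
    have : U 0 p < max_over P (fun i => U 0 i).
      by apply: max_lt => //; [right|move=> j /maxQ_ge /le_lt_trans; apply].
    by rewrite maxE ltxx.
  + apply/andP; split; first by rewrite minQE min_le// QP.
    rewrite leNgt; apply/negP => ltPQ.
    have : min_over P (fun i => U 0 i) < U 0 q.
      by apply: min_gt => //; [right|move=> j /minQ_le; exact: lt_le_trans].
    by rewrite minE ltxx.
Qed.
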